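(* Let $G$ be a graph with $n$ vertices and maximum cut $\beta$. Then \[\gamma_{ir}(G) \geq n + \frac{1- \sqrt{1+8 \beta}}{2}.\] Moreover, the bound is sharp: there exist graphs for which equality holds.
   Context: All graphs are finite, simple, undirected and have at least one vertex. $N(v)$ denotes the set of neighbours of a vertex $v$. A dominating set of $G$ is a set $D \subseteq V(G)$ such that every vertex in $V(G)\setminus D$ has a neighbour in $D$. An irregular dominating set of $G$ is a dominating set $D$ of $G$ such that $|N(u) \cap D| \neq |N(v) \cap D|$ for every two distinct vertices $u, v \in V(G) \setminus D$ (in particular, $V(G)$ is one). The irregular domination number $\gamma_{ir}(G)$ is the size of a smallest irregular dominating set of $G$. For $A \subseteq V(G)$, $e(A, V(G)\setminus A)$ is the number of edges of $G$ with one vertex in $A$ and the other in $V(G) \setminus A$. The maximum cut of $G$ is $\beta = \beta(G) = \max\{e(A, V(G)\setminus A) : A \subseteq V(G)\}$. *)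

(* Defs.v *)
From HB Require Import structures.
From mathcomp Require Import all_boot all_order all_algebra.

Set Implicit Arguments.
Unset Strict Implicit.
Unset Printing Implicit Defensive.

Record sgraph := SGraph {
  vertex :> finType;
  adj : rel vertex;
  adj_sym : symmetric adj;
  adj_irrefl : irreflexive adj;
  vertex_gt0 : 0 < #|vertex|
}.

Definition neighbours (G : sgraph) (v : G) : {set G} := [set u | adj v u].

Definition dominating (G : sgraph) (D : {set G}) : bool :=
  [forall v in ~: D, exists u in D, u \in neighbours v].

Definition irregular_dominating (G : sgraph) (D : {set G}) : bool :=
  dominating D &&
  [forall u in ~: D, forall v in ~: D,
     (u != v) ==> (#|neighbours u :&: D| != #|neighbours v :&: D|)].

(* Makes the minimum in [gamma_ir] range over a nonempty family. *)
Lemma irregular_dominating_setT (G : sgraph) :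
  irregular_dominating [set: G].
Proof.
by apply/andP; split; apply/forall_inP => v; rewrite setCT inE.
Qed.

Definition gamma_ir (G : sgraph) : nat :=
  #|[arg min_(D < [set: G] | irregular_dominating D) #|D| ]|.

(* Edges are unordered pairs. *)
Definition cut_edges (G : sgraph) (A : {set G}) : {set {set G}} :=
  [set [set u; v] | u in A, v in ~: A & adj u v].

Definition max_cut (G : sgraph) : nat := \max_(A : {set G}) #|cut_edges A|.

(* Main.v *)
(** If [D] is an irregular dominating set of minimum size and [k = n - |D|],
    the [k] vertices outside [D] have pairwise distinct positive numbers of
    neighbours in [D], so the cut between [D] and its complement has at least
    [1 + 2 + ... + k] edges; hence [k (k + 1) <= 2 beta], which is the bound.
    The complete graph on two vertices attains it, with [n = 2], [beta = 1]
    and [gamma_ir = 1]. *)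
Require Import Defs.
From HB Require Import structures.
From mathcomp Require Import all_boot all_order all_algebra.
From mathcomp Require Import zify lra.

Set Implicit Arguments.
Unset Strict Implicit.
Unset Printing Implicit Defensive.

Import Order.TTheory GRing.Theory Num.Theory.
Local Open Scope ring_scope.

Lemma leq_card_inj_bounded (T : finType) (S : {set T}) (f : T -> nat) (m : nat) :
  {in S &, injective f} -> {in S, forall x, 0 < f x <= m}%N -> (#|S| <= m)%N.
Proof.
move=> injf fm; rewrite -[m]card_ord.
(* Subtracting one moves the values from 1..m to 0..m-1. [inord] needs a successor bound, hence
   [m.-1.+1], which equals [m] as soon as [S] has an element. *)
have injg : {in S &, injective (fun x => (inord (f x).-1 : 'I_m.-1.+1))}.
  move=> x y xS yS /(congr1 val) /=.
  by move: (fm x xS) (fm y yS) => ? ?; rewrite !inordK; try lia;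
    move=> e; apply: injf => //; lia.
have [->|/set0Pn[x0 x0S]] := eqVneq S set0; first by rewrite cards0.
have m_gt0 : (0 < m)%N by move: (fm x0 x0S); lia.
by rewrite -(card_in_imset injg) card_ord -[leqRHS](prednK m_gt0)
  -[leqRHS]card_ord max_card.
Qed.

(** Induction on the size of [S], removing an element [x] where [f] is largest: [f] injects [S] into
    1..[f x], so [x] alone contributes at least [#|S|]. *)
Lemma bin2_leq_sum_inj (T : finType) (S : {set T}) (f : T -> nat) :
  {in S &, injective f} -> {in S, forall x, 0 < f x}%N ->
  ('C(#|S|.+1, 2) <= \sum_(x in S) f x)%N.
Proof.
have [k] := ubnP #|S|; elim: k S => // k IHk S ltSk injf f_gt0.
have [->|/set0Pn[x0 x0S]] := eqVneq S set0; first by rewrite cards0.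
case: (arg_maxnP f x0S) => x /= xS maxx; have {}xS : x \in S by [].
have cardS : (#|S| <= f x)%N.
  by apply: (leq_card_inj_bounded injf) => y yS; rewrite f_gt0 //=; exact: maxx.
have sSx : {subset S :\ x <= S} by apply/subsetP; exact: subD1set.
have := cardsD1 x S; rewrite xS => eS.
rewrite (big_setD1 x xS) /= binS bin1 addnC leq_add // eS add1n.
apply: IHk; first by lia.
  exact: sub_in2 injf.
exact: sub_in1 f_gt0.
Qed.

(** The sum counts ordered adjacent pairs leading from outside [D] into [D]. Forgetting the order is
    injective on them, since membership in [D] tells the endpoints apart. *)
Lemma sum_neighbours_leq_cut_edges (G : sgraph) (D : {set G}) :
  (\sum_(v in ~: D) #|neighbours v :&: D| <= #|cut_edges (~: D)|)%N.
Proof.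
pose P := [set p : G * G | (p.1 \notin D) && (p.2 \in neighbours p.1 :&: D)].
have -> : (\sum_(v in ~: D) #|neighbours v :&: D| = #|P|)%N.
  rewrite -sum1_card.
  under eq_bigr do rewrite -sum1_card.
  by rewrite pair_big_dep; apply: eq_bigl => -[u v]; rewrite !inE.
have injP : {in P &, injective (fun p : G * G => [set p.1; p.2])}.
  move=> [u v] [u' v']; rewrite !inE /=.
  move=> /and3P[uD _ vD] /and3P[u'D _ v'D] e.
  have /set2P[] : u \in [set u'; v'] by rewrite -e set21.
    move=> eu; have /set2P[] : v \in [set u'; v'] by rewrite -e set22.
      by move=> ev; rewrite -ev vD in u'D.
    by move=> ->; rewrite eu.
  by move=> eu; rewrite eu v'D in uD.
rewrite -(card_in_imset injP); apply/subset_leq_card/subsetP => _ /imsetP[[u v] + ->].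
rewrite !inE /= => /and3P[uD uv vD].
by apply: imset2_f; rewrite ?inE ?negbK ?vD.
Qed.

Lemma bin2_leq_max_cut (G : sgraph) (D : {set G}) :
  irregular_dominating D -> ('C(#|~: D|.+1, 2) <= max_cut G)%N.
Proof.
move=> /andP[/forall_inP domD /forall_inP irrD].
apply: leq_trans (leq_bigmax (~: D)).
apply: leq_trans (sum_neighbours_leq_cut_edges D).
apply: bin2_leq_sum_inj => [u v uD vD e|v vD].
  apply/eqP; have := forall_inP (irrD u uD) v vD.
  by rewrite e eqxx implybF negbK.
have /exists_inP[u uD uv] := domD v vD.
by rewrite card_gt0; apply/set0Pn; exists u; rewrite inE uv.
Qed.

Lemma gamma_ir_witness (G : sgraph) :
  {D : {set G} | irregular_dominating D & gamma_ir G = #|D|}.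
Proof.
rewrite /gamma_ir; case: arg_minnP => [|D irrD _]; last by exists D.
exact: irregular_dominating_setT.
Qed.

Lemma gamma_ir_min (G : sgraph) (D : {set G}) :
  irregular_dominating D -> (gamma_ir G <= #|D|)%N.
Proof.
rewrite /gamma_ir; case: arg_minnP => [|D' _ minD' /minD' //].
exact: irregular_dominating_setT.
Qed.

Lemma gamma_ir_lower_bound (R : rcfType) (G : sgraph) :
  #|G|%:R + (1 - Num.sqrt (1 + 8 * (max_cut G)%:R)) / 2 <= (gamma_ir G)%:R :> R.
Proof.
have [D /bin2_leq_max_cut lecut ->] := gamma_ir_witness G.
rewrite -(cardsC D) natrD; set k := #|~: D| in lecut *.
(* Completing the square: twice ['C(k.+1, 2)] is k(k+1), and 4k(k+1) + 1 = (2k+1)^2. *)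
have : ((2 * k + 1) ^ 2 <= 1 + 8 * max_cut G)%N.
  by move: lecut (mul_bin_diag k.+1 1); rewrite /= bin1; nia.
rewrite -(ler_nat R) => le_sq.
have {}le_sq : (2 * k%:R + 1) ^+ 2 <= 1 + 8 * (max_cut G)%:R :> R by lra.
have := ler_wsqrtr le_sq.
rewrite sqrtr_sqr ger0_norm; last by rewrite addr_ge0 ?mulr_ge0 ?ler0n.
lra.
Qed.

(** Kept transparent so that vertices compute to booleans in the case analyses below. *)
Definition K2 : sgraph.
Proof.
by refine (@SGraph bool (fun u v => u != v) _ _ _);
  [move=> u v; rewrite eq_sym | move=> u; rewrite eqxx | rewrite card_bool].
Defined.

Lemma max_cut_K2 : (max_cut K2 <= 1)%N.
Proof.
(* Any cut edge has two distinct ends, hence is the whole vertex set. *)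
apply/bigmax_leqP => A _; rewrite -(cards1 [set: K2]).
apply/subset_leq_card/subsetP => _ /imset2P[u v _ + ->].
rewrite !inE => /andP[_ /= uv]; apply/eqP/setP => w; rewrite !inE.
by case: u v w uv => [] [] [].
Qed.

Lemma gamma_ir_K2 : (gamma_ir K2 <= 1)%N.
Proof.
(* Only one vertex lies outside the singleton of [true], so irregularity is vacuous. *)
rewrite -(cards1 (true : K2)); apply: gamma_ir_min; apply/andP; split.
  apply/forall_inP => v; rewrite !inE => vF; apply/exists_inP.
  by exists (true : K2); rewrite !inE.
apply/forall_inP => u; rewrite !inE => uF; apply/forall_inP => v.
by rewrite !inE; case: u v uF => [] [].
Qed.

Theorem theorem4p2 (R : rcfType) :
  (forall G : sgraph,
     (gamma_ir G)%:R >=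
       #|G|%:R + (1 - Num.sqrt (1 + 8 * (max_cut G)%:R)) / 2 :> R) /\
  (exists G : sgraph,
     (gamma_ir G)%:R =
       #|G|%:R + (1 - Num.sqrt (1 + 8 * (max_cut G)%:R)) / 2 :> R).
Proof.
split; first exact: gamma_ir_lower_bound.
(* With one direction given by the general bound, upper estimates suffice for the other: a cut of at
   most 1 makes the right side at least 2 + (1 - 3)/2 = 1. *)
exists K2; apply/le_anti; rewrite gamma_ir_lower_bound andbT.
have cut1 : (max_cut K2)%:R <= 1 :> R by rewrite lern1 max_cut_K2.
have gamma1 : (gamma_ir K2)%:R <= 1 :> R by rewrite lern1 gamma_ir_K2.
have : Num.sqrt (1 + 8 * (max_cut K2)%:R) <= 3 :> R.
  rewrite -[leRHS]ger0_norm ?ler0n // -sqrtr_sqr ler_wsqrtr //; lra.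
rewrite card_bool; lra.
Qed.
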